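(* For every integer $k\ge 1$ there exists an SF-extendable arrangement of $k$ line segments.
   Context: An arrangement of $k$ line segments is a set of $k$ segments in the plane whose $2k$ endpoints are distinct and in general position (no three collinear). A complete geometric graph on a finite point set $P$ in general position is the complete graph on $P$ with edges drawn as straight line segments; a subgraph is plane if no two of its edges cross. A star is a connected graph with one vertex (the center) adjacent to all other vertices and no other edges; a star-forest is a forest each of whose components is a star. An arrangement of $k$ segments is SF-extendable if the complete geometric graph on the $2k$ endpoints of the segments admits a partition of its edge set into $k+1$ plane star-forests, one of which is the perfect matching formed by the $k$ segments. *)

(* Defs.v *)
From HB Require Import structures.
From mathcomp Require Import all_boot all_order all_algebra.
From mathcomp Require Import reals.

Set Implicit Arguments.
Unset Strict Implicit.
Unset Printing Implicit Defensive.

Import Order.TTheory GRing.Theory Num.Theory.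
Local Open Scope ring_scope.

(* A simple graph on the vertex set V is given by its edge set, a set of
   two-element subsets of V; subgraphs of the complete graph are spanning, so
   vertices not covered by E are isolated vertices of the graph. *)
Section Graphs.
Variable V : finType.
Implicit Types (E : {set {set V}}) (W : {set V}).

Definition complete_edges : {set {set V}} := [set e : {set V} | #|e| == 2].

Definition adj E : rel V := fun x y => [set x; y] \in E.

Definition component E (x : V) : {set V} := [set y | connect (adj E) x y].

Definition induced_edges E W : {set {set V}} := [set e in E | e \subset W].

Definition forest E : Prop :=
  forall s : seq V, (2 < size s)%N -> ~ ucycle (adj E) s.

(* Connectedness of the graph (W, E) follows from the shape of E; a single
   vertex without edges is a star. *)
Definition star W E : Prop :=
  exists2 c, c \in W & E = [set [set c; x] | x in W :\ c].

Definition star_forest E : Prop :=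
  forest E /\
  forall x, star (component E x) (induced_edges E (component E x)).

End Graphs.

Section Geometry.
Variable R : realType.

Definition collinear (a b c : 'rV[R]_2) : Prop :=
  exists o d : 'rV[R]_2, d != 0 /\
    forall q, q \in [:: a; b; c] -> exists t : R, q = o + t *: d.

Definition open_segment (a b q : 'rV[R]_2) : Prop :=
  exists2 t : R, 0 < t < 1 & q = (1 - t) *: a + t *: b.

Section Drawing.
Variables (V : finType) (p : V -> 'rV[R]_2).

Definition general_position : Prop :=
  forall x y z, uniq [:: x; y; z] -> ~ collinear (p x) (p y) (p z).

Definition edge_interior (e : {set V}) (q : 'rV[R]_2) : Prop :=
  exists x y, [/\ x != y, e = [set x; y] & open_segment (p x) (p y) q].

(* For points in general position, distinct edges can only meet at a common
   endpoint or at a point interior to both. *)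
Definition cross (e f : {set V}) : Prop :=
  e != f /\ exists q, edge_interior e q /\ edge_interior f q.

Definition plane_graph (E : {set {set V}}) : Prop :=
  forall e f, e \in E -> f \in E -> ~ cross e f.

End Drawing.

(* The i-th segment joins endpoint (i, false) and endpoint (i, true). *)
Record arrangement (k : nat) := Arrangement {
  endpoint : 'I_k * bool -> 'rV[R]_2;
  endpoint_inj : injective endpoint;
  endpoint_general_position : general_position endpoint
}.

Definition segment_matching (k : nat) : {set {set 'I_k * bool}} :=
  [set [set (i, false); (i, true)] | i : 'I_k].

(* The k + 1 classes are an indexed family, so that a class may be empty: this
   is unavoidable for k = 1, where the complete graph has a single edge. *)
Definition SF_extendable (k : nat) (A : arrangement k) : Prop :=
  exists F : 'I_k.+1 -> {set {set 'I_k * bool}},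
    [/\ \bigcup_i F i = complete_edges ('I_k * bool)%type,
        forall i j, i != j -> [disjoint F i & F j],
        forall i, star_forest (F i) /\ plane_graph (endpoint A) (F i)
      & exists i, F i = segment_matching k].

End Geometry.

(* Main.v *)
Require Import Defs.
From mathcomp Require Import all_boot all_order all_algebra.
From mathcomp Require Import reals.
From mathcomp Require Import ring lra.

Set Implicit Arguments.
Unset Strict Implicit.
Unset Printing Implicit Defensive.

Import Order.TTheory GRing.Theory Num.Theory.
Local Open Scope ring_scope.

(** Put [a_i = (-w_i, w_i^2)] on the parabola [y = x^2], with [w_i = 4^-i], and
    [b_i = a_i + (1, -2 w_i)] on the tangent at [a_i].  The [i]-th star-forest
    has centers [a_i] and [b_i]: for [h < i < j], the center [a_i] is joined to
    [a_h] and [b_j], and [b_i] to [b_h] and [a_j].  Between segments [i < j]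
    this gives the edges [a_i b_j], [b_i a_j] to forest [i] and [a_i a_j],
    [b_i b_j] to forest [j].  All neighbours of [a_i] lie to the left of the
    line [a_i b_i], so its edges miss the edges [b_i b_h], which lie to the
    right; and the line [a_i a_j] separates the edge [b_i a_j] from the star at
    [a_i], because chords from [a_i] to later points have smaller slope than the
    tangents at all later points. *)

Lemma set2_eq (T : finType) (x y z w : T) :
  [set x; y] = [set z; w] -> (x = z /\ y = w) \/ (x = w /\ y = z).
Proof.
move=> E.
have: x \in [set z; w] by rewrite -E set21.
have: y \in [set z; w] by rewrite -E set22.
have: z \in [set x; y] by rewrite E set21.
have: w \in [set x; y] by rewrite E set22.
rewrite !inE => /orP[] /eqP-> /orP[] /eqP-> /orP[] /eqP H /orP[] /eqP H';
  by [left | right | left; subst | right; subst].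
Qed.

(** * Star-forests as fibres of idempotent maps *)

Section Retraction.
Variables (V : finType) (r : V -> V).

(** A star-forest is encoded by the map [r] sending each vertex to the center of its star; for
    idempotent [r] the fibres are the components. *)
Definition retract_edges : {set {set V}} := [set [set x; r x] | x : V & r x != x].

Lemma retract_edgesP x y :
  ([set x; y] \in retract_edges) = (x != y) && ((r x == y) || (r y == x)).
Proof.
apply/imsetP/andP => [[z]|[xy /orP[] /eqP E]].
- rewrite inE => rz /set2_eq [] [-> ->]; rewrite eqxx ?orbT; split=> //.
  by rewrite eq_sym.
- by exists x; rewrite ?inE E // eq_sym.
- by exists y; rewrite ?inE E // setUC.
Qed.

Hypothesis rK : forall x, r (r x) = r x.

Lemma adj_retractP x y : adj retract_edges x y ->
  [/\ x != y, r x = r y & (x == r x) || (y == r x)].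
Proof.
rewrite /adj retract_edgesP => /andP[xy /orP[] /eqP E]; split=> //.
- by rewrite -E rK.
- by rewrite -E eqxx orbT.
- by rewrite -E rK.
- by rewrite -E rK eqxx.
Qed.

Lemma component_retract x :
  component retract_edges x = [set y | r y == r x].
Proof.
have sym : connect_sym (adj retract_edges).
  by apply: sym_connect_sym => y z; rewrite /adj setUC.
have to_r z : connect (adj retract_edges) z (r z).
  have [E|N] := eqVneq z (r z); first by rewrite -E.
  by apply: connect1; rewrite /adj retract_edgesP N eqxx.
apply/setP => y; rewrite !inE; apply/idP/eqP => [|E]; last first.
  by apply: connect_trans (to_r x) _; rewrite sym -E.
case/connectP => s; elim: s x => [|z s IH] x /= => [_ -> //|].
by case/andP=> /adj_retractP [_ -> _] ps; apply: IH.
Qed.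

Lemma star_forest_retract : star_forest retract_edges.
Proof.
split=> [s ss /andP[]|x].
  case: s ss => [|x [|y [|z t]]] //= _ /and3P[xy yz cyc].
  rewrite !inE !negb_or => /and3P[/and3P[_ nxz _] /andP[nyz nyt] _].
  (* [u] follows [z] on the cycle, and is [x] on a triangle. The edges [xy], [yz], [zu] all contain
     the center [r y]: if it is [y], then [zu] misses it; otherwise [x] and [z] both equal it. *)
  have [u zu nyu] : exists2 u, adj retract_edges z u & y != u.
    case: t cyc nyt => [|u t] /= /andP[zu _] nyt.
      by exists x; rewrite // eq_sym; case/adj_retractP: xy.
    by exists u => //; move: nyt; rewrite inE negb_or => /andP[].
  case/adj_retractP: xy => nxy rxy; rewrite rxy.
  case/adj_retractP: yz => _ ryz; case/adj_retractP: zu => _ _; rewrite -ryz.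
  have [<- /orP[]|_] := eqVneq y (r y).
  - by rewrite eq_sym (negbTE nyz).
  - by rewrite eq_sym (negbTE nyu).
  by rewrite orbF => _ /= /eqP <- /eqP E; rewrite E eqxx in nxz.
rewrite component_retract; exists (r x); first by rewrite inE rK.
apply/setP => e; rewrite inE; apply/andP/imsetP.
  case=> /imsetP[y]; rewrite inE => ry -> /subsetP S.
  have := S _ (set21 _ _); rewrite inE => /eqP E.
  by exists y; rewrite ?inE E ?eqxx // -E ?andbT 1?eq_sym // setUC.
case=> y; rewrite !inE => /andP[yr /eqP ry] ->; split.
  by apply/imsetP; exists y; rewrite ?inE ry 1?eq_sym // setUC.
by apply/subsetP => z; rewrite !inE => /orP[] /eqP->; rewrite ?rK ?ry.
Qed.

End Retraction.

(** * Partition of the complete graph into the matching and the double stars *)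

(* [None] encodes the matching and [Some i] the [i]-th double star. *)
Definition center_map k (o : option 'I_k) (v : 'I_k * bool) : 'I_k * bool :=
  if o is Some i then if v.1 == i then v else (i, v.2 (+) (i < v.1)%N)
  else (v.1, false).

Lemma center_mapK k o (v : 'I_k * bool) :
  center_map o (center_map o v) = center_map o v.
Proof. by case: o => [i|] //=; case E: (v.1 == i); rewrite /= ?E ?eqxx. Qed.

Lemma matching_edgeP k (e : {set 'I_k * bool}) :
  e \in retract_edges (center_map None) -> exists i, e = [set (i, false); (i, true)].
Proof.
case/imsetP => [[i b]]; rewrite inE /= xpair_eqE eqxx /=; case: b => // _ ->.
by exists i; rewrite // setUC.
Qed.

Lemma double_star_edgeP k (i : 'I_k) (e : {set 'I_k * bool}) :
  e \in retract_edges (center_map (Some i)) ->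
  exists2 j, j != i & exists c, e = [set (i, c); (j, c (+) (i < j)%N)].
Proof.
case/imsetP => [[j c]]; rewrite inE /=; case: ifP => [_|/negbT ji _ ->].
  by rewrite eqxx.
by exists j => //; exists (c (+) (i < j)%N); rewrite -addbA addbb addbF setUC.
Qed.

(** Exactly one of [i < j] and [j < i] holds, so an edge between segments [i] and [j] that fails the
    bit test of center map [i] passes that of [j]. *)
Lemma center_map_cover k (e : {set 'I_k * bool}) : #|e| == 2 ->
  exists o, e \in retract_edges (center_map o).
Proof.
case/cards2P => [[i b] [[j c] [xy ->]]].
have [ij|ij] := eqVneq i j.
  exists None; rewrite retract_edgesP xy /= ij !xpair_eqE eqxx /=.
  by move: xy; rewrite ij xpair_eqE eqxx; case: (b) (c) => [] [].
have [bc|bc] := eqVneq (c (+) (i < j)%N) b.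
  exists (Some i).
  by rewrite retract_edgesP xy /= [j == i]eq_sym (negbTE ij) bc !eqxx orbT.
exists (Some j); rewrite retract_edgesP xy /= (negbTE ij).
suff -> : b (+) (j < i)%N = c by rewrite eqxx.
by move: bc ij; rewrite -val_eqE /=; case: ltngtP => // _; case: (b) (c) => [] [].
Qed.

Lemma center_map_disjoint k (o o' : option 'I_k) : o != o' ->
  [disjoint retract_edges (center_map o) & retract_edges (center_map o')].
Proof.
move=> oo'; apply/pred0P => e; apply/negP => /= /andP[].
case: o o' oo' => [i|] [j|] // oo'.
- case/double_star_edgeP=> m mi [c ->] /double_star_edgeP[l lj [d /set2_eq[]]].
    by case=> [[ij _] _]; rewrite ij eqxx in oo'.
  (* The bit [d] would be unchanged after flips by both [i < j] and [j < i], of which exactly one is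
     true. *)
  case=> -[<- E] [mj E']; move: mi E'; rewrite {}E {}mj -val_eqE /=.
  by case: ltngtP => // _ _; case: (d).
- by case/double_star_edgeP=> m mi [c ->] /matching_edgeP[l /set2_eq[]];
    case=> [[E _] [E' _]]; rewrite E E' eqxx in mi.
- by case/matching_edgeP=> l -> /double_star_edgeP[m mj [c /set2_eq[]]];
    case=> [[E _] [E' _]]; rewrite -E -E' eqxx in mj.
Qed.

(** * Orientation of triples and disjointness of segments *)

Section Orientation.
Variable R : realType.
Implicit Types p q s x y z w : 'rV[R]_2.

(** Twice the signed area of the triangle, positive when [s] lies left of the directed line
    [p q]. *)
Definition orient p q s : R :=
  (q 0 0 - p 0 0) * (s 0 1 - p 0 1) - (q 0 1 - p 0 1) * (s 0 0 - p 0 0).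

Lemma orientC p q s : orient p s q = - orient p q s.
Proof. rewrite /orient; ring. Qed.

Lemma orient_rot p q s : orient q s p = orient p q s.
Proof. rewrite /orient; ring. Qed.

Lemma orient_refl p q : orient p q p = 0 /\ orient p q q = 0.
Proof. by split; rewrite /orient; ring. Qed.

Lemma orient_conv p q x y t :
  orient p q ((1 - t) *: x + t *: y) = (1 - t) * orient p q x + t * orient p q y.
Proof. rewrite /orient !mxE; ring. Qed.

Lemma collinear_orient p q s : collinear p q s -> orient p q s = 0.
Proof.
case=> o [d [_ H]].
have [t1 ->] := H p (mem_head _ _).
have [t2 ->] : exists t, q = o + t *: d by apply: H; rewrite !inE eqxx orbT.
have [t3 ->] : exists t, s = o + t *: d by apply: H; rewrite !inE eqxx !orbT.
rewrite /orient !mxE; ring.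
Qed.

Lemma open_segmentC x y q : open_segment x y q -> open_segment y x q.
Proof.
case=> t t01 ->; exists (1 - t); first by lra.
by rewrite opprB addrCA subrr addr0 addrC.
Qed.

Lemma open_segments_fan c x y q :
  orient c x y != 0 -> open_segment c x q -> open_segment c y q -> False.
Proof.
move=> /eqP N [t /andP[t0 t1] ->] [u /andP[u0 u1] E]; apply: N.
have := orient_conv c x c y u; rewrite -E orient_conv.
have [-> ->] := orient_refl c x; rewrite !mulr0 addr0 add0r => /esym/eqP.
by rewrite mulf_eq0 gt_eqF //= => /eqP.
Qed.

(** One strict inequality puts the whole open segment [x y] strictly on the left, so the separating
    line may pass through the endpoint [x]. *)
Lemma open_segments_sep p q x y z w s :
  0 <= orient p q x -> 0 < orient p q y ->
  orient p q z <= 0 -> orient p q w <= 0 ->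
  open_segment x y s -> open_segment z w s -> False.
Proof.
move=> px py pz pw [t /andP[t0 t1] ->] [u /andP[u0 u1] E].
have := orient_conv p q z w u; rewrite -E orient_conv; nra.
Qed.

Lemma edge_interior_segment (V : finType) (f : V -> 'rV[R]_2) (x y : V) q :
  edge_interior f [set x; y] q -> open_segment (f x) (f y) q.
Proof.
by case=> [z [w [_ /set2_eq[[-> ->]|[-> ->]] //]]]; apply: open_segmentC.
Qed.

End Orientation.

(** * The point set and its general position *)

Section Construction.
Variable R : realType.

(* [pt w_i false] is [a_i] and [pt w_i true] is [b_i]. *)
Definition pt (w : R) (c : bool) : 'rV[R]_2 :=
  \row_j (if j == 0 then c%:R - w else w ^+ 2 - (c%:R * w) *+ 2).

Implicit Types w u v : R.

Lemma pt_fst w c : pt w c 0 0 = c%:R - w. Proof. by rewrite mxE. Qed.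

Lemma pt_snd w c : pt w c 0 1 = w ^+ 2 - (c%:R * w) *+ 2.
Proof. by rewrite mxE. Qed.

Let ptE := (pt_fst, pt_snd).

(** For [c = false] this is a square, as the parabola lies above its tangents; for [c = true] and
    weights in [(0, 1]] it has the sign of [w - u]. *)
Lemma orient_tangent w u c :
  orient (pt w false) (pt w true) (pt u c) = (w - u) * (w - u + c%:R *+ 2).
Proof. rewrite /orient !ptE /=; ring. Qed.

(** A Vandermonde determinant: the points [a] lie on [y = x^2], the points [b] on [y = x^2 - 1]. *)
Lemma orient_same c w u v :
  orient (pt w c) (pt u c) (pt v c) = (w - u) * (w - v) * (u - v).
Proof. rewrite /orient !ptE /=; ring. Qed.

Lemma orient_fft w u v : orient (pt w false) (pt u false) (pt v true) =
  (w - u) * ((1 + w - v) * (1 + u - v) - 1).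
Proof. rewrite /orient !ptE /=; ring. Qed.

Lemma orient_ftt w u v : orient (pt w false) (pt u true) (pt v true) =
  (u - v) * ((1 + w - u) * (1 + w - v) + 1).
Proof. rewrite /orient !ptE /=; ring. Qed.

Definition wt (i : nat) : R := (4^-1) ^+ i.

Lemma wt_bounds i : 0 < wt i <= 1.
Proof. by rewrite /wt exprn_gt0 ?exprn_ile1 //=; lra. Qed.

Lemma wt_lt i j : (i < j)%N -> 4 * wt j <= wt i.
Proof.
move=> /subnKC <-; rewrite /wt addSn exprS mulrA mulfV ?mul1r ?exprD ?pnatr_eq0 //.
by rewrite ler_piMr ?exprn_ge0 ?exprn_ile1 //=; lra.
Qed.

Lemma wt_inj : injective wt.
Proof.
move=> i j E; case: (ltngtP i j) => // /wt_lt; rewrite E => L; exfalso;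
  have := wt_bounds j; lra.
Qed.

(** For weights [w], [u], [v] of [i], [j], [m], the second factor of [orient_fft] is
    [w + u - 2 v + (w - v) (u - v)]. The ratio [4] gives [w - 2 v >= 2 v], while the product exceeds
    [-v]. *)
Lemma orient_fft_gt0 i j m : (i < j)%N -> (i < m)%N ->
  0 < orient (pt (wt i) false) (pt (wt j) false) (pt (wt m) true).
Proof.
move=> /wt_lt ij /wt_lt im; rewrite orient_fft.
have /andP[i0 i1] := wt_bounds i; have /andP[j0 j1] := wt_bounds j.
have /andP[m0 m1] := wt_bounds m; apply: mulr_gt0; nra.
Qed.

Lemma orient_fft_neq0 i j m : i != j ->
  orient (pt (wt i) false) (pt (wt j) false) (pt (wt m) true) != 0.
Proof.
wlog lt_ij : i j / (i < j)%N => [H|_].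
  case: (ltngtP i j) => [ij|ji|//] _; first by apply: H; rewrite // ltn_eqF.
  by rewrite -orient_rot orientC oppr_eq0 orient_rot -orient_rot H // ltn_eqF.
have [im|mi] := ltnP i m; first by rewrite gt_eqF // orient_fft_gt0.
(* When [m <= i < j], both [1 + w - v] and [1 + u - v] lie in [(0, 1]], the latter below [1], so the
   second factor of [orient_fft] is negative. *)
have le_w : wt i <= wt m.
  move: mi; rewrite leq_eqVlt => /orP[/eqP->//|/wt_lt].
  by have := wt_bounds i; lra.
rewrite orient_fft; have := wt_lt lt_ij; have := wt_bounds i.
have := wt_bounds j; have := wt_bounds m.
move=> /andP[? ?] /andP[? ?] /andP[? ?] ?.
by rewrite mulf_neq0 //; [rewrite gt_eqF | rewrite lt_eqF]; nra.
Qed.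

Lemma orient_ftt_neq0 i j m : j != m ->
  orient (pt (wt i) false) (pt (wt j) true) (pt (wt m) true) != 0.
Proof.
move=> jm; rewrite orient_ftt mulf_neq0 ?subr_eq0 ?(inj_eq wt_inj) //.
have /andP[? ?] := wt_bounds i; have /andP[? ?] := wt_bounds j.
have /andP[? ?] := wt_bounds m; rewrite gt_eqF //; nra.
Qed.

Lemma orient_same_neq0 c i j m : i != j -> i != m -> j != m ->
  orient (pt (wt i) c) (pt (wt j) c) (pt (wt m) c) != 0.
Proof.
by move=> ij im jm; rewrite orient_same !mulf_neq0 ?subr_eq0 ?(inj_eq wt_inj).
Qed.

Variable k : nat.
Notation V := ('I_k * bool)%type.

Definition vertex (v : V) : 'rV[R]_2 := pt (wt v.1) v.2.

Lemma vertex_orient_neq0 x y z : x != y -> x != z -> y != z ->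
  orient (vertex x) (vertex y) (vertex z) != 0.
Proof.
case: x y z => [i b] [j c] [m d]; rewrite /vertex !xpair_eqE /=.
case: b c d => [] [] [] /=; rewrite ?andbT ?andbF => xy xz yz.
- exact: orient_same_neq0.
- by rewrite orient_rot orient_ftt_neq0.
- by rewrite -orient_rot orient_ftt_neq0 // eq_sym.
- by rewrite -orient_rot orient_fft_neq0.
- exact: orient_ftt_neq0.
- by rewrite orientC oppr_eq0 orient_fft_neq0.
- exact: orient_fft_neq0.
- exact: orient_same_neq0.
Qed.

Lemma vertex_inj : injective vertex.
Proof.
move=> [i b] [j c] /rowP/(_ 0); rewrite !mxE /= => E.
have /andP[i0 i1] := wt_bounds i; have /andP[j0 j1] := wt_bounds j.
have bc : b = c by case: (b) (c) E => [] [] //= E; exfalso; lra.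
congr (_, _) => //; apply/val_inj/wt_inj; rewrite bc in E; lra.
Qed.

Lemma vertex_general_position : general_position vertex.
Proof.
move=> x y z; rewrite /= !inE negb_or => /andP[/andP[xy xz] /andP[yz _]].
by move=> /collinear_orient/eqP; apply/negP/vertex_orient_neq0.
Qed.

Lemma vertices_fan (c x y : V) q : c != x -> c != y -> x != y ->
  open_segment (vertex c) (vertex x) q -> open_segment (vertex c) (vertex y) q ->
  False.
Proof.
by move=> cx cy xy; apply/open_segments_fan/vertex_orient_neq0.
Qed.

(** * Planarity of the matching and of the double stars *)

(** The condition on [c] admits every neighbour of [a_i] in double star [i], and both ends of any
    later segment, as the matching requires. *)
Lemma orient_segment_gt0 (i j : nat) c : i != j -> c ==> (i < j)%N ->
  0 < orient (pt (wt i) false) (pt (wt i) true) (pt (wt j) c).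
Proof.
rewrite orient_tangent; have /andP[? ?] := wt_bounds j.
by case: (ltngtP i j) c => [/wt_lt ?|/wt_lt ?|->] [] //= _ _; nra.
Qed.

Lemma stars_separated (i j m : 'I_k) q : j != i -> m != i ->
  open_segment (vertex (i, false)) (vertex (j, (i < j)%N)) q ->
  open_segment (vertex (i, true)) (vertex (m, ~~ (i < m)%N)) q -> False.
Proof.
rewrite /vertex -!val_eqE /= => ji mi.
have [_ ab] := orient_refl (pt (wt i) false) (pt (wt i) true).
have [aa _] := orient_refl (pt (wt i) false) (pt (wt i) true).
have jp : 0 < orient (pt (wt i) false) (pt (wt i) true) (pt (wt j) (i < j)%N).
  by apply: orient_segment_gt0; rewrite ?implybb // eq_sym.
case: (ltngtP i m) mi => // [im|/wt_lt mi] _ /=; last first.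
  apply: open_segments_sep jp _ _; rewrite ?aa ?ab //.
  have /andP[? ?] := wt_bounds m; have /andP[? ?] := wt_bounds i.
  rewrite orient_tangent /=; nra.
move=> s1 /open_segmentC.
have [aa' am] := orient_refl (pt (wt i) false) (pt (wt m) false).
apply: (open_segments_sep (p := pt (wt i) false) (q := pt (wt m) false))
  _ _ _ _ s1; rewrite ?aa' ?am //.
  (* Left of the line [a_i a_m]: a later neighbour of [a_i] is [b_j], settled by comparing slopes;
     an earlier one is [a_j], settled by convexity of the parabola. *)
  case: (ltngtP i j) ji => // [ij|/wt_lt ji] _; first exact: orient_fft_gt0.
  rewrite orient_same; have /wt_lt := im; have := wt_bounds i.
  by have := wt_bounds m; move=> *; rewrite -mulrA mulr_gt0 ?nmulr_rgt0; lra.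
by rewrite orientC oppr_le0 orient_tangent mulr0n mul0rn addr0 -expr2 sqr_ge0.
Qed.

Lemma plane_matching : plane_graph vertex (retract_edges (center_map None)).
Proof.
move=> e f /matching_edgeP[i ->] /matching_edgeP[j ->] [ef [q []]].
move=> /edge_interior_segment + /edge_interior_segment.
have {ef}: (i < j)%N || (j < i)%N.
  by rewrite -neq_ltn val_eqE; apply: contraNneq ef => ->.
wlog ij : i j / (i < j)%N => [H /orP[] ij si sj|_ si sj].
- by apply: (H i j) si sj; rewrite ij.
- by apply: (H j i) sj si; rewrite ij.
have [aa bb] := orient_refl (pt (wt i) false) (pt (wt i) true).
move: sj si; apply: (open_segments_sep (p := pt (wt i) false)
  (q := pt (wt i) true)); rewrite /vertex /= ?aa ?bb ?lexx //.
  by rewrite ltW ?orient_segment_gt0 ?ij ?neq_ltn ?ij.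
by rewrite orient_segment_gt0 ?neq_ltn ?ij.
Qed.

Lemma plane_double_star i : plane_graph vertex (retract_edges (center_map (Some i))).
Proof.
move=> e f /double_star_edgeP[j ji [c ->]].
move=> /double_star_edgeP[m mi [d ->]] [ef [q []]].
move=> /edge_interior_segment + /edge_interior_segment.
have neq_i x b b' : x != i -> (i, b) != (x, b').
  by rewrite xpair_eqE eq_sym => /negbTE->.
(* Equal bits mean a common center, hence a fan; different bits mean one edge at each of the two
   centers. *)
case: c d ef => [] [] ef /= s1 s2.
- by apply: vertices_fan s1 s2; rewrite ?neq_i //; apply: contraNneq ef => ->.
- exact: stars_separated s2 s1.
- exact: stars_separated s1 s2.
- by apply: vertices_fan s1 s2; rewrite ?neq_i //; apply: contraNneq ef => ->.
Qed.

End Construction.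

Theorem theorem3 (R : realType) (k : nat) (hk : (1 <= k)%N) :
  exists A : arrangement R k, SF_extendable A.
Proof.
exists (Arrangement (@vertex_inj R k) (@vertex_general_position R k)).
(* [unlift ord_max] sends the last index to [None], the matching, and the other [k] indices to the
   double stars. *)
exists (fun i : 'I_k.+1 => retract_edges (center_map (unlift ord_max i))); split.
- apply/setP => e; rewrite !inE; apply/bigcupP/idP => [[i _ /imsetP[x]]|].
    by rewrite inE eq_sym => xr ->; rewrite cards2 xr.
  case/center_map_cover => o oe; exists (oapp (lift ord_max) ord_max o) => //.
  by case: o oe => [i|] /=; rewrite ?liftK ?unlift_none.
- move=> i j ij; apply: center_map_disjoint.
  case: (unliftP ord_max i) ij => [i' ->|->];
  case: (unliftP ord_max j) => [j' ->|->];
  by rewrite ?eqxx // (inj_eq lift_inj).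
- move=> i; split; first exact/star_forest_retract/center_mapK.
  case: (unlift ord_max i) => [j|]; first exact: plane_double_star.
  exact: plane_matching.
exists ord_max; rewrite unlift_none; apply/setP => e; apply/idP/imsetP.
  by case/matching_edgeP=> i ->; exists i.
by case=> i _ ->; rewrite retract_edgesP /= !xpair_eqE !eqxx.
Qed.
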